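(* Let $s,c\ge 1$, let $t_1,t_2,\ldots,t_s$ and $n_1,n_2,\ldots,n_c$ be positive integers with $n_1\geq n_2\geq\cdots\geq n_c$, and put $\Sigma=\sum_{i=1}^{s}(t_i-1)$ and $r=R(S_{t_1},S_{t_2},\ldots,S_{t_s})$. Then $$R(S_{t_1},S_{t_2},\ldots,S_{t_s},n_1K_2,n_2K_2,\ldots,n_cK_2)=\max\{r+\delta,\,n_1\}+\sum_{i=1}^{c}(n_i-1)+1,$$ where $\delta=0$ if $\Sigma<\max\{n_1,2n_2\}$, $\Sigma$ is even and some $t_i$ is even, and $\delta=-1$ otherwise. (When $c=1$, $\max\{n_1,2n_2\}$ is read as $n_1$.)
   Context: All graphs are finite, simple and undirected. $S_n$ denotes the star with $n$ edges (that is, $K_{1,n}$), and $nK_2$ denotes a matching of size $n$, i.e. $n$ pairwise disjoint edges. For graphs $G_1,\ldots,G_m$, the Ramsey number $R(G_1,\ldots,G_m)$ is the smallest positive integer $n$ such that whenever the edges of the complete graph $K_n$ are partitioned into $m$ disjoint (possibly empty) color classes giving graphs $H_1,\ldots,H_m$, at least one $H_i$ contains a subgraph isomorphic to $G_i$. *)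

(* Defs.v *)
From mathcomp Require Import boolp classical_sets.
From mathcomp Require Import all_boot.

Set Implicit Arguments.
Unset Strict Implicit.
Unset Printing Implicit Defensive.

Local Open Scope nat_scope.

Record graph_on (V : finType) := GraphOn {
  edge :> rel V;
  edge_sym : symmetric edge;
  edge_irr : irreflexive edge }.

Record graph := Graph { vertex : finType; adj : graph_on vertex }.

(* A subgraph need not be induced: only adjacency is preserved. *)
Definition contains_copy (V : finType) (H : graph_on V) (G : graph) : Prop :=
  exists f : vertex G -> V,
    injective f /\ forall x y, adj G x y -> H (f x) (f y).

(* Since each H i is irreflexive and symmetric, this says that the edge sets
   of the H i, some possibly empty, partition the edge set of K_n. *)
Definition edge_partition (I : finType) (n : nat) (H : I -> graph_on 'I_n) :
    Prop :=
  forall x y : 'I_n, x != y -> exists! i, H i x y.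

Definition arrows (n : nat) (I : finType) (G : I -> graph) : Prop :=
  forall H : I -> graph_on 'I_n, edge_partition H ->
    exists i, contains_copy (H i) (G i).

Definition is_ramsey_number (I : finType) (G : I -> graph) (n : nat) : Prop :=
  [/\ 0 < n, arrows n G & forall k, 0 < k -> arrows k G -> n <= k].

(* The default value 0 is only taken for the empty family, see ramseyP. *)
Definition ramsey (I : finType) (G : I -> graph) : nat :=
  xget 0 [set n | is_ramsey_number G n]%classic.

(* The list of graphs obtained by appending the family G' to the family G. *)
Definition fam_cat (I J : finType) (G : I -> graph) (G' : J -> graph)
    (k : I + J) : graph :=
  match k with inl i => G i | inr j => G' j end.

(* The star K_{1,n}, with centre None. *)
Definition star_rel (n : nat) : rel (option 'I_n) :=
  fun x y => (x == None) != (y == None).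

Fact star_sym n : symmetric (@star_rel n).
Proof. by move=> x y; rewrite /star_rel eq_sym. Qed.

Fact star_irr n : irreflexive (@star_rel n).
Proof. by move=> x; rewrite /star_rel eqxx. Qed.

Definition star (n : nat) : graph := Graph (GraphOn (@star_sym n) (@star_irr n)).

(* The matching n K_2: the i-th edge joins (i, false) and (i, true). *)
Definition matching_rel (n : nat) : rel ('I_n * bool) :=
  fun x y => (x.1 == y.1) && (x.2 != y.2).

Fact matching_sym n : symmetric (@matching_rel n).
Proof. by move=> x y; rewrite /matching_rel eq_sym [x.2 == _]eq_sym. Qed.

Fact matching_irr n : irreflexive (@matching_rel n).
Proof. by move=> x; rewrite /matching_rel !eqxx. Qed.

Definition matching (n : nat) : graph :=
  Graph (GraphOn (@matching_sym n) (@matching_irr n)).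

Lemma ramsey_clique (I : finType) (i0 : I) (k : nat) (g : I -> nat) :
  \sum_i g i <= k ->
  exists N, forall (T : finType) (E : I -> rel T) (A : {set T}),
    (forall i, symmetric (E i)) ->
    (forall x y, x != y -> exists i, E i x y) ->
    N <= #|A| ->
    exists i (S : {set T}), [/\ S \subset A, #|S| = g i &
      {in S &, forall x y, x != y -> E i x y}].
Proof.
elim: k g => [|k IH] g gk.
  exists 0 => T E A _ _ _; exists i0, set0; rewrite sub0set cards0; split=> //.
    by move: gk; rewrite leqn0 (bigD1 i0) //= addn_eq0 => /andP[/eqP->].
  by move=> x y; rewrite inE.
have [/existsP[i /eqP gi]|] := boolP [exists i, g i == 0].
  exists 0 => T E A _ _ _; exists i, set0; rewrite sub0set cards0 gi; split=> //.
  by move=> x y; rewrite inE.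
rewrite negb_exists => /forallP g0.
pose g' i j := if j == i then (g j).-1 else g j.
have /fin_all_exists[N HN] : forall i, exists N, forall (T : finType)
    (E : I -> rel T) (A : {set T}),
    (forall i, symmetric (E i)) ->
    (forall x y, x != y -> exists i, E i x y) ->
    N <= #|A| ->
    exists j (S : {set T}), [/\ S \subset A, #|S| = g' i j &
      {in S &, forall x y, x != y -> E j x y}].
  move=> i; apply: IH; rewrite -ltnS; apply: leq_trans gk.
  rewrite (bigD1 i) //= [X in _ < X](bigD1 i) //= /g' eqxx.
  rewrite (eq_bigr g) => [|j /negPf->//].
  by rewrite ltn_add2r ltn_predL lt0n.
exists (\sum_i N i).+1 => T E A Es Et NA.
have [v vA] : exists v, v \in A by apply/card_gt0P; apply: leq_trans NA.
pose B i := [set u in A :\ v | E i v u].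
have [i Bi] : exists i, N i <= #|B i|.
  apply/existsP; apply: contraLR NA; rewrite negb_exists -ltnNge => /forallP BN.
  rewrite ltnS (cardsD1 v) vA add1n.
  have sub : A :\ v \subset \bigcup_i B i.
    apply/subsetP=> u uA; have [|i Ei] := Et v u.
      by move: uA; rewrite !inE eq_sym => /andP[].
    by apply/bigcupP; exists i => //; rewrite inE uA.
  apply: leq_ltn_trans (subset_leq_card sub) _.
  apply: (@leq_ltn_trans (\sum_i #|B i|)).
    elim/big_ind2: _ => [|X a Y b Xa Yb|//]; first by rewrite cards0.
    by apply: leq_trans (leq_card_setU _ _) _; apply: leq_add.
  rewrite (bigD1 i0) //= [X in _ < X](bigD1 i0) //= -addSn.
  by apply: leq_add; [|apply: leq_sum => j _; apply: ltnW]; rewrite ltnNge.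
have [j [S [SB cS ES]]] := HN i T E (B i) Es Et Bi.
have SA : S \subset A.
  by apply/subsetP=> u /(subsetP SB); rewrite !inE => /andP[/andP[]].
move: cS; rewrite /g'; case: eqP => [ji|_] cS; last by exists j, S.
exists i, (v |: S); subst j; split.
- by rewrite subUset sub1set vA.
- rewrite cardsU1 cS.
  case: (boolP (v \in S)) => [/(subsetP SB)|_]; first by rewrite !inE eqxx.
  by rewrite add1n prednK // lt0n.
move=> x y /setU1P[->|xS] /setU1P[->|yS]; first by rewrite eqxx.
- by move: yS => /(subsetP SB); rewrite inE => /andP[].
- by move: xS => /(subsetP SB); rewrite inE Es => /andP[].
exact: ES.
Qed.

Lemma ramsey_exists (I : finType) (G : I -> graph) :
  0 < #|I| -> exists n, 0 < n /\ arrows n G.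
Proof.
case/card_gt0P=> i0 _; pose g i := #|vertex (G i)|.
have [N HN] := ramsey_clique i0 (leqnn (\sum_i g i)).
exists N.+1; split=> // H Hp.
have [i|x y /Hp[i [Hi _]]||i [S [_ cS ES]]] :=
  HN _ (fun i => edge (H i)) [set: 'I_N.+1].
- exact: edge_sym.
- by exists i.
- by rewrite cardsT card_ord.
exists i; exists (fun x => enum_val (cast_ord (esym cS) (enum_rank x))).
have inj : injective (fun x : vertex (G i) =>
    enum_val (cast_ord (esym cS) (enum_rank x))).
  by move=> x y /enum_val_inj /cast_ord_inj /enum_rank_inj.
split=> // x y xy; apply: ES; try exact: enum_valP.
by rewrite (inj_eq inj); apply: contraTneq xy => ->; rewrite edge_irr.
Qed.

Lemma ramseyP (I : finType) (G : I -> graph) :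
  0 < #|I| -> is_ramsey_number G (ramsey G).
Proof.
move=> I0; have [n [n0 nG]] := ramsey_exists G I0; rewrite /ramsey.
have ex : exists n, `[< 0 < n /\ arrows n G >] by exists n; apply/asboolP.
case: (ex_minnP ex) => m /asboolP[m0 mG] mmin.
apply: (@xgetPex _ 0 (is_ramsey_number G)); exists m.
by split=> // k k0 kG; apply: mmin; apply/asboolP.
Qed.

(* Main.v *)
Require Import Defs.
From mathcomp Require Import boolp.
From mathcomp Require Import all_boot all_order all_algebra zify.
Import Order.TTheory GRing.Theory Num.Theory.

(** Put D for the sum of the t_i - 1 and m_i = n_i - 1.  Call the colours of
    the stars red; a colouring of a complete graph without the forbidden graphs
    has at most t_i - 1 edges of the i-th red colour at each vertex, so at most
    D red edges, and a maximum matching of size at most m_j in the j-th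
    remaining colour.  The Ramsey number is one more than the largest order of
    such a colouring.

    Upper bound ([coloring_bound]).  Deleting a vertex that lies in every
    maximum matching of some colour lowers the order by one and the sum of the
    matching numbers by at least one, so one may work in a set B where in each
    colour j every vertex is missed by some maximum matching
    ([exists_critical]).  By Gallai's lemma, the relation that two vertices are
    never missed by the same maximum matching is then an equivalence
    ([tied_trans]) that contains adjacency; its classes are odd, and the sum of
    |C| - 1 over the classes C is at most twice the matching number nu_j.  If
    two vertices x and y of B are in different classes for every colour, adding
    the degrees of x and y gives 2 (|B| - 1) <= 2 D + 2 (sum of the nu_j).
    Otherwise the classes cover all pairs; in a minimal set of colours that
    still does it, some pair is covered by one colour i only, and adding the
    degrees gives |B| - 1 <= (sum of the nu_j) + nu_i ([all_tied_bound]), where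
    nu_i < n_1.

    When D is even and some t_i is even, the first bound can be improved by one
    provided that D >= n_1 and D >= 2 n_2: in the case of equality every vertex
    of B turns out to have exactly t_i - 1 edges of each red colour i and |B|
    turns out to be odd, which contradicts the handshake lemma
    ([tight_contradiction]).  With no matchings at all, the same bound gives
    the upper half of the theorem of Burr and Roberts on stars
    ([ramsey_stars]).

    Lower bound.  Starting from a coloured complete graph on a set W, one adds
    for each j a set of vertices all of whose edges have the j-th matching
    colour ([extend_not_arrows]).  For W one takes a complete graph with red
    edges only, of order D + 1, or D if parity forbids it
    ([exists_star_coloring]); or a clique of order 2 n_1 - 1 in the first
    matching colour; or, when D is even and less than 2 n_2, two cliques of
    order D + 1 in the first two matching colours that share a vertex, the
    other edges being red ([not_arrows_two_cliques]). *)

Set Implicit Arguments.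
Unset Strict Implicit.
Unset Printing Implicit Defensive.

(** * Involutions and double counting *)

Lemma card_free_involution (T : finType) (D : {set T}) (f : T -> T) :
  {in D, forall x, f x \in D} -> {in D, forall x, f (f x) = x} ->
  {in D, forall x, f x != x} ->
  #|D| = (#|[set x in D | enum_rank x < enum_rank (f x)]|).*2.
Proof.
move=> fD ff fx; set L := [set x in D | _].
have injf : {in L &, injective f}.
  move=> x y; rewrite !inE => /andP[xD _] /andP[yD _] E.
  by rewrite -(ff x) // E ff.
have -> : D = L :|: f @: L.
  apply/setP=> x; rewrite !inE; apply/idP/orP => [xD|].
    have [lt|ge] := ltnP (enum_rank x) (enum_rank (f x)).
      by left; rewrite xD.
    right; apply/imsetP; exists (f x); last by rewrite ff.
    rewrite inE fD //= ff // ltn_neqAle ge andbT.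
    by apply: contraNneq (fx _ xD) => /val_inj/enum_rank_inj->.
  by case=> [/andP[]//|/imsetP[y]]; rewrite inE => /andP[yD _] ->; apply: fD.
have dis : L :&: f @: L = set0.
  apply/setP=> x; rewrite !inE; apply/negP => /andP[/andP[xD lt]].
  case/imsetP=> y; rewrite inE => /andP[yD lt2] E.
  by move: lt; rewrite E ff // ltnNge ltnW.
by rewrite cardsU dis cards0 subn0 card_in_imset // addnn.
Qed.

(** Swapping the ends is a fixed-point-free involution of the set of darts. *)
Lemma handshake (T : finType) (B : {set T}) (H : rel T) :
  symmetric H -> irreflexive H ->
  ~~ odd (\sum_(x in B) #|[set y in B | H x y]|).
Proof.
move=> Hs Hi.
pose D := [set p : T * T | [&& p.1 \in B, p.2 \in B & H p.1 p.2]].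
have -> : \sum_(x in B) #|[set y in B | H x y]| = #|D|.
  under eq_bigr do rewrite -sum1_card.
  rewrite pair_big_dep /= -sum1_card; apply: eq_bigl => -[x y] /=.
  by rewrite !inE.
rewrite (@card_free_involution _ D (fun p => (p.2, p.1))) ?odd_double //.
- by move=> [x y]; rewrite !inE /= Hs => /and3P[-> -> ->].
- by move=> [].
move=> [x y]; rewrite inE /= => /and3P[_ _ h].
by apply: contraTneq h => -[->]; rewrite Hi.
Qed.

(** * Maximum matchings and vertex deletion *)

Section Matching.
Variables (T : finType) (G : rel T).
Implicit Types (A B : {set T}) (f g : {ffun T -> T}).

(** A matching is encoded as the involution that swaps the ends of its edges
    and fixes the vertices that it misses. *)
Definition matches B f :=
  [forall x, (f (f x) == x) && ((f x != x) ==> (x \in B) && G x (f x))].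

Definition moved f := [set x | f x != x].

Definition nu B := \max_(f | matches B f) #|moved f|./2.

Definition maximum B f := matches B f && (nu B == #|moved f|./2).

(** This is the hypothesis of Gallai's lemma, without connectedness: deleting
    a vertex of [B] does not lower the matching number. *)
Definition critical B :=
  [forall (x | x \in B), exists f, maximum B f && (f x == x)].

Lemma matchesK B f : matches B f -> involutive f.
Proof. by move=> /forallP fM x; have /andP[/eqP] := fM x. Qed.

Lemma matches_edge B f x : matches B f -> f x != x -> (x \in B) && G x (f x).
Proof. by move=> /forallP fM; have /andP[_ /implyP] := fM x. Qed.

Lemma matches_in B f x : matches B f -> f x != x -> f x \in B.
Proof.
move=> fM fx; have /(matches_edge fM) /andP[]// : f (f x) != f x.
by rewrite (matchesK fM) eq_sym.
Qed.

Lemma card_moved B f : matches B f -> #|moved f| = (#|moved f|./2).*2.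
Proof.
move=> fM; have fK := matchesK fM.
rewrite (@card_free_involution _ (moved f) f) ?doubleK // => x; rewrite !inE //.
by rewrite fK eq_sym.
Qed.

Lemma matches_sub A B f : A \subset B -> matches A f -> matches B f.
Proof.
move=> /subsetP AB /forallP fM; apply/forallP => x; have /andP[-> /=] := fM x.
by case: (f x != x) => //= /andP[/AB-> ->].
Qed.

Lemma nu_ge B f : matches B f -> #|moved f|./2 <= nu B.
Proof. by move=> fM; rewrite /nu (bigD1 f) //= leq_maxl. Qed.

Lemma exists_maximum B : exists f, maximum B f.
Proof.
have idM : [ffun x => x] \in matches B.
  by apply/forallP => x; rewrite !ffunE !eqxx.
have [|f fM E] := @eq_bigmax_cond _ (matches B) (fun f => #|moved f|./2).
  by apply/card_gt0P; exists [ffun x => x].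
by exists f; apply/andP; split; [exact: fM | rewrite /nu -E].
Qed.

Lemma nu_mono A B : A \subset B -> nu A <= nu B.
Proof.
by move=> AB; apply/bigmax_leqP => f /(matches_sub AB); apply: nu_ge.
Qed.

(** If no maximum matching misses [x], deleting [x] destroys them all. *)
Lemma nu_drop B : ~~ critical B -> exists2 x, x \in B & nu (B :\ x) < nu B.
Proof.
rewrite negb_forall => /existsP[x]; rewrite negb_imply => /andP[xB nf].
exists x => //; rewrite ltn_neqAle nu_mono ?subsetDl // andbT.
apply: contra nf => /eqP E; have [f /andP[fM /eqP fn]] := exists_maximum (B :\ x).
apply/existsP; exists f; rewrite /maximum (matches_sub _ fM) ?subsetDl //.
rewrite -E fn eqxx /=; apply: contraT => /(matches_edge fM).
by rewrite !inE eqxx.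
Qed.

End Matching.

(** Each deletion lowers the order by one and the sum of the matching numbers
    by at least one, so the difference of the two never decreases. *)
Lemma exists_critical (T J : finType) (G : J -> rel T) (A : {set T}) :
  exists B : {set T}, [/\ B \subset A, forall j, critical (G j) B &
    #|A| + \sum_j nu (G j) B <= #|B| + \sum_j nu (G j) A].
Proof.
have [k] := ubnP #|A|; elim: k A => // k IH A; rewrite ltnS => Ak.
have [crit|] := boolP [forall j, critical (G j) A].
  by exists A; split=> //; apply/forallP.
rewrite negb_forall => /existsP[j /nu_drop[x xA lt]].
have cA := cardsD1 x A; rewrite xA in cA.
have [|B [BA Bc le]] := IH (A :\ x); first by lia.
exists B; split=> //; first exact: subset_trans BA (subsetDl _ _).
have : \sum_i nu (G i) (A :\ x) < \sum_i nu (G i) A.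
  rewrite (bigD1 j) //= [X in _ < X](bigD1 j) //= -addSn leq_add //.
  by apply: leq_sum => i _; apply: nu_mono; apply: subsetDl.
lia.
Qed.

(** * Gallai's lemma *)

Section Gallai.
Variables (T : finType) (G : rel T) (B : {set T}).
Hypotheses (Gsym : symmetric G) (Girr : irreflexive G) (Bcrit : critical G B).
Implicit Types (f g : {ffun T -> T}).

Definition tied : rel T := fun x y =>
  (x == y) || [forall f, maximum G B f ==> ~~ ((f x == x) && (f y == y))].

Lemma tied_sym : symmetric tied.
Proof.
move=> x y; rewrite /tied eq_sym; congr (_ || _).
by apply: eq_forallb => f; rewrite [(f x == x) && _]andbC.
Qed.

Lemma tiedP x y : reflect
  (x = y \/ forall f, maximum G B f -> f x = x -> f y = y -> False) (tied x y).
Proof.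
apply: (iffP orP) => [[/eqP|/forallP h]|[->|h]].
- by left.
- right=> f fm fx fy; have := h f.
  by rewrite fm fx fy !eqxx.
- by left.
right; apply/forallP => f; apply/implyP => fm; apply/negP.
move=> /andP[/eqP fx /eqP fy]; exact: h fm fx fy.
Qed.

(** Otherwise the edge could be added to a matching that misses both ends. *)
Lemma edge_tied x y : x \in B -> y \in B -> G x y -> tied x y.
Proof.
move=> xB yB Gxy; apply/tiedP; right=> f /andP[fM /eqP fn] fx fy.
have xy : x != y by apply: contraTneq Gxy => ->; rewrite Girr.
have fK := matchesK fM.
pose g := [ffun z => if z == x then y else if z == y then x else f z].
have ge z : z != x -> z != y -> g z = f z.
  by move=> /negPf zx /negPf zy; rewrite ffunE zx zy.
have gx : g x = y by rewrite ffunE eqxx.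
have gy : g y = x by rewrite ffunE eqxx eq_sym (negPf xy).
have gM : matches G B g.
  apply/forallP => z.
  have [->|zx] := eqVneq z x; first by rewrite gx gy eqxx xB Gxy implybT.
  have [->|zy] := eqVneq z y; first by rewrite gy gx eqxx yB Gsym Gxy implybT.
  have fzx : f z != x by rewrite -[x]fx (inj_eq (inv_inj fK)).
  have fzy : f z != y by rewrite -[y]fy (inj_eq (inv_inj fK)).
  by rewrite !ge // fK eqxx; apply/implyP => /(matches_edge fM).
have mg : moved g = x |: (y |: moved f).
  apply/setP=> z; rewrite !inE.
  have [->|zx] := eqVneq z x; first by rewrite gx eq_sym xy.
  have [->|zy] := eqVneq z y; first by rewrite gy xy.
  by rewrite ge.
have := nu_ge gM; rewrite fn mg !cardsU1 !inE (negPf xy) fx fy !eqxx /=.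
lia.
Qed.

(** This replaces [f] by [g] on a union [P] of components of the union of the
    two matchings. *)
Definition swap (P : {set T}) f g := [ffun x => if x \in P then g x else f x].

Lemma swap_matches (P : {set T}) f g :
  {in P, forall x, f x \in P} -> {in P, forall x, g x \in P} ->
  matches G B f -> matches G B g -> matches G B (swap P f g).
Proof.
move=> fP gP fM gM; apply/forallP => x; rewrite !ffunE.
have [xP|xP] := boolP (x \in P).
  rewrite gP // (matchesK gM) eqxx; apply/implyP => /(matches_edge gM) //.
have fxP : f x \notin P.
  by apply: contra xP => /fP; rewrite (matchesK fM).
by rewrite (negPf fxP) (matchesK fM) eqxx; apply/implyP => /(matches_edge fM).
Qed.

(** The two exchanges of [f] and [g] on [P] have together as many edges as [f]
    and [g], so neither can be smaller than a maximum matching. *)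
Lemma swap_maximum (P : {set T}) f g :
  {in P, forall x, f x \in P} -> {in P, forall x, g x \in P} ->
  maximum G B f -> maximum G B g -> maximum G B (swap P f g).
Proof.
move=> fP gP /andP[fM /eqP fn] /andP[gM /eqP gn].
have M1 := swap_matches fP gP fM gM; have M2 := swap_matches gP fP gM fM.
rewrite /maximum M1 /=.
have split_moved h1 h2 : #|moved (swap P h1 h2)|
    = #|moved h2 :&: P| + #|moved h1 :\: P|.
  rewrite -(cardsID P); congr (_ + _); apply: eq_card => x; rewrite !inE ffunE.
    by case: (x \in P); rewrite ?andbF.
  by case: (x \in P).
have E1 := split_moved f g; have E2 := split_moved g f.
have E3 := cardsID P (moved f); have E4 := cardsID P (moved g).
have := nu_ge M1; have := nu_ge M2.
have := card_moved M1; have := card_moved M2.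
have := card_moved fM; have := card_moved gM.
lia.
Qed.

(** This is the core of Gallai's lemma.  Suppose that the maximum matching [f]
    misses [u] and [v], and that [g] misses [w].  Follow the path of [f] and
    [g] edges from [w].  It cannot contain both [u] and [v], as it has only one
    end besides [w]; exchanging [f] and [g] along it gives a maximum matching
    that misses [w] and one of [u] and [v]. *)
Lemma tied_trans u w v :
  w \in B -> tied u w -> tied w v -> tied u v.
Proof.
move=> wB /tiedP[->//|uw] /tiedP[<-|wv]; first exact/tiedP/or_intror.
have [->|uv] := eqVneq u v; first by rewrite /tied eqxx.
apply/tiedP; right => f fm fu fv.
have /existsP[g /andP[gm /eqP gw]] := forall_inP Bcrit w wB.
have fK := matchesK (proj1 (andP fm)); have gK := matchesK (proj1 (andP gm)).
pose h x := g (f x).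
have hinj : injective h by move=> x y /(inv_inj gK) /(inv_inj fK).
pose P := [set x | fconnect h w x].
(* As [g] fixes [w] and inverts [h], the orbit of [w] under [h] is closed
   under [g], hence under [f]. *)
have gh k : g (iter k h w) \in P /\ iter k h (g (iter k h w)) = w.
  elim: k => [|k [IH1 IH2]]; first by rewrite /= gw inE connect0.
  have E : h (g (iter k.+1 h w)) = g (iter k h w) by rewrite iterS /h gK fK.
  split; last by rewrite iterSr E.
  move: IH1; rewrite !inE -E => /connect_trans; apply.
  by rewrite fconnect_sym // fconnect1.
have gP : {in P, forall x, g x \in P}.
  by move=> x; rewrite inE => /iter_findex <-; case: (gh (findex h w x)).
have hP : {in P, forall x, h x \in P}.
  by move=> x; rewrite !inE => /connect_trans; apply; apply: fconnect1.
have fP : {in P, forall x, f x \in P}.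
  by move=> x /hP/gP; rewrite /h gK.
(* On this orbit [f] is the reflection that sends index [k] to [- k - 1];
   a fixed point makes the length of the orbit odd. *)
have per k : f (iter k h w) = iter k h w -> iter (k + k).+1 h w = w.
  move=> E; rewrite -addSn iterD -[RHS](gh k.+1).2; congr (iter _ _ _).
  by rewrite iterS /h gK E.
have mul d k : iter d h w = w -> iter (k * d) h w = w.
  by move=> E; elim: k => // k IH; rewrite mulSn iterD IH.
have uniqP : u \in P -> v \in P -> u = v.
  rewrite !inE => /iter_findex; move: (findex h w u) => a Ea.
  move/iter_findex; move: (findex h w v) => b Eb.
  wlog ab : a b u v Ea Eb fu fv {uv uw wv} / a <= b.
    move=> W; have [/W|/ltnW/W] := leqP a b; first exact.
    by move=> W'; apply/esym/W'.
  have Ha : iter (a + a).+1 h w = w by apply: per; rewrite Ea.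
  have Hb : iter (b + b).+1 h w = w by apply: per; rewrite Eb.
  suff Hd : iter (b - a) h w = w by rewrite -Ea -Eb -[in RHS](subnKC ab) iterD Hd.
  (* The difference of two fixed indices is killed by 2 and by an odd number. *)
  have H2 : iter (2 * (b - a)) h w = w.
    have iter_inj m : injective (iter m h) by elim: m => // m IH x y /hinj/IH.
    apply: (iter_inj (a + a).+1); rewrite -iterD Ha.
    by have -> : (a + a).+1 + 2 * (b - a) = (b + b).+1 by lia.
  rewrite -[RHS](mul _ (b - a) Ha) -[X in iter _ _ X = _](mul _ a H2) -iterD.
  by have -> : b - a + a * (2 * (b - a)) = (b - a) * (a + a).+1 by lia.
have gxm := swap_maximum fP gP fm gm.
have gxw : swap P f g w = w by rewrite ffunE gw inE connect0.
have [uP|uP] := boolP (u \in P).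
  have [vP|vP] := boolP (v \in P); first by rewrite uniqP ?eqxx in uv.
  by apply: (wv _ gxm gxw); rewrite ffunE (negPf vP).
by apply: (uw _ gxm _ gxw); rewrite ffunE (negPf uP).
Qed.

Definition mates x := [set y in B | (y != x) && tied x y].

(** A maximum matching that misses [x] covers every other vertex of the class
    of [x], and its edges do not leave the class. *)
Lemma even_mates x : x \in B -> ~~ odd #|mates x|.
Proof.
move=> xB; have /existsP[f /andP[fm /eqP fx]] := forall_inP Bcrit x xB.
have /andP[fM _] := fm; have fK := matchesK fM.
have moves : {in mates x, forall y, f y != y}.
  move=> y; rewrite inE => /and3P[_ yx /tiedP[xy|h]]; first by rewrite xy eqxx in yx.
  by apply/eqP => /(h _ fm fx).
rewrite (card_free_involution (f := f)) ?odd_double // => y yN.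
have /(matches_edge fM)/andP[yB Gy] := moves _ yN.
have fyB := matches_in fM (moves _ yN).
move: yN; rewrite !inE fyB => /and3P[_ yx xy] /=; apply/andP; split.
  by apply: contra yx => /eqP E; rewrite -[y]fK E fx.
exact: tied_trans xy (edge_tied yB fyB Gy).
Qed.

(** A maximum matching misses at most one vertex of each class. *)
Lemma sum_mates_le (Z : {set T}) :
  Z \subset B -> {in Z &, forall x y, tied x y -> x = y} ->
  \sum_(z in Z) #|mates z| <= (nu G B).*2.
Proof.
move=> /subsetP ZB Zt; have [f fm] := exists_maximum G B.
have /andP[fM /eqP ->] := fm; rewrite -(card_moved fM).
pose C z := [set y in B | tied z y].
have leC z : z \in Z -> #|mates z| <= #|C z :&: moved f|.
  move=> /ZB zB; have <- : #|C z|.-1 = #|mates z|.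
    rewrite (cardsD1 z) inE zB /tied eqxx /=; apply: eq_card => y.
    by rewrite !inE andbCA.
  rewrite -(cardsID (moved f) (C z)).
  have : #|C z :\: moved f| <= 1.
    apply/card_le1_eqP => y y'; rewrite !inE !negbK.
    move=> /and3P[/eqP fy yB zy] /and3P[/eqP fy' yB' zy'].
    have /tiedP[//|h] : tied y y'.
      by apply: (tied_trans (w := z)) => //; rewrite tied_sym.
    by have := h _ fm fy fy'.
  lia.
apply: (@leq_trans (\sum_(z in Z) #|C z :&: moved f|)).
  exact: leq_sum leC.
under eq_bigr do rewrite -sum1_card.
rewrite (exchange_big_dep (mem (moved f))) /=; last by move=> z y _ /setIP[].
rewrite -[leqRHS]sum1_card; apply: leq_sum => y ym; rewrite sum1_card.
apply/card_le1_eqP => z z' /andP[zZ]; rewrite !inE => /andP[/andP[yB zy] _].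
move=> /andP[zZ']; rewrite !inE => /andP[/andP[_ zy'] _].
by apply: Zt => //; apply: tied_trans zy' _; rewrite // tied_sym.
Qed.

Lemma mates_le1 x : x \in B -> #|mates x| <= (nu G B).*2.
Proof.
move=> xB; have := @sum_mates_le [set x]; rewrite big_set1; apply.
  by rewrite sub1set.
by move=> y z /set1P-> /set1P->.
Qed.

Lemma mates_le2 x y : x \in B -> y \in B -> ~~ tied x y ->
  #|mates x| + #|mates y| <= (nu G B).*2.
Proof.
move=> xB yB xy; have := @sum_mates_le [set x; y].
rewrite big_setU1 ?big_set1 /=; last first.
  by apply: contra xy; rewrite inE => /eqP->; rewrite /tied eqxx.
apply; first by rewrite subUset !sub1set xB.
by move=> a b /set2P[]-> /set2P[]-> //; rewrite ?(tied_sym y) (negPf xy).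
Qed.

Lemma mates_le3 x y z : x \in B -> y \in B -> z \in B ->
  ~~ tied x y -> ~~ tied x z -> ~~ tied y z ->
  #|mates x| + #|mates y| + #|mates z| <= (nu G B).*2.
Proof.
move=> xB yB zB xy xz yz; have := @sum_mates_le (x |: [set y; z]).
have ne a b : ~~ tied a b -> a != b.
  by apply: contra => /eqP->; rewrite /tied eqxx.
rewrite !big_setU1 ?big_set1 ?inE /= ?negb_or ?ne // addnA.
apply; first by rewrite !subUset !sub1set xB yB.
by move=> a b /setU1P[->|/set2P[]->] /setU1P[->|/set2P[]->] //;
  rewrite ?(tied_sym y x) ?(tied_sym z) (negPf xy, negPf xz, negPf yz).
Qed.

End Gallai.

(** * The upper bound *)

Lemma card_le_sum (I T : finType) (P : pred I) (A : {set T}) (F : I -> {set T}) :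
  (forall x, x \in A -> exists2 i, P i & x \in F i) ->
  #|A| <= \sum_(i | P i) #|F i|.
Proof.
move=> AF; apply: (@leq_trans #|\bigcup_(i | P i) F i|).
  apply: subset_leq_card; apply/subsetP => x /AF[i Pi xi].
  by apply/bigcupP; exists i.
elim/big_ind2: _ => [|X a Y b Xa Yb|//]; first by rewrite cards0.
by apply: leq_trans (leq_card_setU _ _) _; apply: leq_add.
Qed.

Lemma eq_of_sum_le (I : finType) (f g : I -> nat) :
  (forall i, f i <= g i) -> \sum_i g i <= \sum_i f i -> forall i, f i = g i.
Proof.
move=> fg le i; apply/eqP; move: le; apply: contraTT => ne; rewrite -ltnNge.
rewrite (bigD1 i) //= [X in _ < X](bigD1 i) //= -addSn leq_add ?leq_sum //.
by rewrite ltn_neqAle ne fg.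
Qed.

Section Upper.
Variables (T K J : finType) (R : K -> rel T) (G : J -> rel T) (u : K -> nat).
Hypotheses (Rsym : forall k, symmetric (R k)) (Rirr : forall k, irreflexive (R k)).
Hypotheses (Gsym : forall j, symmetric (G j)) (Girr : forall j, irreflexive (G j)).
Hypothesis colored : forall x y, x != y ->
  (exists k, R k x y) \/ (exists j, G j x y).
Hypothesis Guniq : forall x y i j, G i x y -> G j x y -> i = j.
Hypothesis Rdeg : forall k x, #|[set y | R k x y]| <= u k.

Section CriticalSet.
Variable B : {set T}.
Hypothesis Bcrit : forall j, critical (G j) B.

Let D := \sum_k u k.
Let M := \sum_j nu (G j) B.
Let rdeg k x := #|[set y in B | R k x y]|.
Let gdeg j x := #|[set y in B | G j x y]|.
Let cls j x := #|mates (G j) B x|.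

(** The edge of a free pair has a star colour, and in each matching colour the
    pair meets two classes, whose sizes are bounded together. *)
Definition free x y := [forall j, ~~ tied (G j) B x y].

Lemma free_sym : symmetric free.
Proof. by move=> x y; apply: eq_forallb => j; rewrite tied_sym. Qed.

Lemma rdeg_le k x : rdeg k x <= u k.
Proof.
apply: leq_trans (Rdeg k x); apply: subset_leq_card.
by apply/subsetP => y; rewrite !inE => /andP[].
Qed.

Lemma neighbours_sub_mates j x : x \in B ->
  [set y in B | G j x y] \subset mates (G j) B x.
Proof.
move=> xB; apply/subsetP => y; rewrite !inE => /andP[yB Gxy].
by rewrite yB edge_tied ?andbT //=; apply: contraTneq Gxy => ->; rewrite Girr.
Qed.

Lemma gdeg_le j x : x \in B -> gdeg j x <= cls j x.
Proof. by move=> xB; apply: subset_leq_card; apply: neighbours_sub_mates. Qed.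

Lemma degree_sum x : x \in B ->
  #|B| <= (\sum_k rdeg k x + \sum_j gdeg j x).+1.
Proof.
move=> xB; rewrite (cardsD1 x) xB add1n ltnS.
pose F (i : K + J) := match i with
  inl k => [set y in B | R k x y] | inr j => [set y in B | G j x y] end.
apply: (@leq_trans (\sum_i #|F i|)); last by rewrite big_sumType.
apply: card_le_sum => y; rewrite !inE eq_sym => /andP[/colored xy yB].
by case: xy => -[i xy]; [exists (inl i)|exists (inr i)]; rewrite //= inE yB.
Qed.

Lemma tied_sum (P : pred J) x : x \in B ->
  (forall y, y \in B -> y != x -> exists2 j, P j & tied (G j) B x y) ->
  #|B| <= (\sum_(j | P j) cls j x).+1.
Proof.
move=> xB cov; rewrite (cardsD1 x) xB add1n ltnS.
apply: card_le_sum => y; rewrite !inE => /andP[yx yB].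
by have [j Pj xy] := cov y yB yx; exists j; rewrite // inE yB yx.
Qed.

(** Take a minimal set [S] of colours whose classes cover all pairs, [i] in [S]
    and a pair that only [i] covers.  For the other colours of [S] the two
    vertices are in different classes, and colour [i] counts twice. *)
Lemma all_tied_bound : 1 < #|B| ->
  {in B &, forall x y, x != y -> ~~ free x y} ->
  exists i, #|B| <= (M + nu (G i) B).+1.
Proof.
move=> B1 nofree.
pose cov (S : {set J}) := [forall (x | x \in B), forall (y | y \in B),
  (x != y) ==> [exists j in S, tied (G j) B x y]].
have covP (S : {set J}) : reflect (forall x y, x \in B -> y \in B -> y != x ->
    exists2 j, j \in S & tied (G j) B x y) (cov S).
  apply: (iffP 'forall_in_forall_inP) => h x y xB.
    move=> yB yx; have := h x xB y yB; rewrite eq_sym yx => /exists_inP.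
    by case=> j; exists j.
  by move=> xy; apply/implyP; rewrite eq_sym => yx; apply/exists_inP; apply: h.
have [|S /minsetP[Scov Smin]] := @ex_minset _ cov.
  exists setT; apply/covP => x y xB yB; rewrite eq_sym => /(nofree _ _ xB yB).
  by rewrite negb_forall => /existsP[j]; rewrite negbK; exists j.
have [i iS] : exists i, i \in S.
  have /card_gt1P[x [y [xB yB xy]]] := B1; rewrite eq_sym in xy.
  by have [i iS _] := covP _ Scov x y xB yB xy; exists i.
have : ~~ cov (S :\ i).
  apply/negP => /Smin /(_ (subsetDl _ _)) E.
  by move: iS; rewrite -E !inE eqxx.
rewrite negb_forall => /existsP[x]; rewrite negb_imply => /andP[xB].
rewrite negb_forall => /existsP[y]; rewrite negb_imply => /andP[yB].
rewrite negb_imply negb_exists => /andP[xy /forallP untied].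
have sum_le z : z \in B -> #|B| <= (\sum_(j in S) cls j z).+1.
  by move=> zB; apply: tied_sum => // w wB wz; apply: (covP _ Scov).
have lex := sum_le x xB; have ley := sum_le y yB.
have := leq_add lex ley; rewrite (bigD1 i) //= [X in _ + X.+1](bigD1 i) //= {lex ley}.
have : \sum_(j in S | j != i) cls j x + \sum_(j in S | j != i) cls j y
    <= \sum_(j | j != i) (nu (G j) B).*2.
  rewrite -big_split [leqRHS](bigID (mem S)) /= -[leqLHS]addn0 leq_add //.
  under [leqRHS]eq_bigl do rewrite andbC.
  apply: leq_sum => j /andP[jS ji]; apply: mates_le2 => //.
  by have := untied j; rewrite !inE ji jS.
have : cls i x <= (nu (G i) B).*2 := mates_le1 (Bcrit i) xB.
have : cls i y <= (nu (G i) B).*2 := mates_le1 (Bcrit i) yB.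
have -> : \sum_(j | j != i) (nu (G j) B).*2 = (\sum_(j | j != i) nu (G j) B).*2.
  by rewrite -!mul2n big_distrr /=; apply: eq_bigr => j; rewrite mul2n.
exists i; rewrite /M (bigD1 i) //=; lia.
Qed.

Lemma free_pair_sums x y : x \in B -> y \in B -> free x y ->
  [/\ \sum_k rdeg k x <= D, \sum_k rdeg k y <= D,
      \sum_j gdeg j x <= \sum_j cls j x, \sum_j gdeg j y <= \sum_j cls j y &
      \sum_j cls j x + \sum_j cls j y <= M.*2].
Proof.
move=> xB yB /forallP xy; split; try by apply: leq_sum => k _; apply: rdeg_le.
- by apply: leq_sum => j _; apply: gdeg_le.
- by apply: leq_sum => j _; apply: gdeg_le.
rewrite -big_split -mul2n /M big_distrr /=; apply: leq_sum => j _.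
by rewrite mul2n; apply: mates_le2.
Qed.

Lemma free_pair_bound x y : x \in B -> y \in B -> free x y ->
  #|B| <= (D + M).+1.
Proof.
move=> xB yB xy; have [] := free_pair_sums xB yB xy.
have := degree_sum xB; have := degree_sum yB; lia.
Qed.

Section Tight.
Hypothesis Btight : D + M < #|B|.

(** All the inequalities that prove [free_pair_bound] are equalities. *)
Lemma free_pair_tight x y : x \in B -> y \in B -> free x y ->
  [/\ #|B| = (D + M).+1, forall k, rdeg k x = u k,
      forall j, gdeg j x = cls j x, \sum_j cls j x = M &
      forall j, cls j x + cls j y = (nu (G j) B).*2].
Proof.
move=> xB yB xy; have [r1 r2 g1 g2 c] := free_pair_sums xB yB xy.
have d1 := degree_sum xB; have d2 := degree_sum yB.
split; try lia.
- by apply: eq_of_sum_le => [k|]; [apply: rdeg_le | rewrite -/D; lia].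
- by apply: eq_of_sum_le => [j|]; [apply: gdeg_le | lia].
apply: eq_of_sum_le => [j|].
  by apply: mates_le2 => //; move/forallP: xy.
rewrite big_split /=.
have -> : \sum_j (nu (G j) B).*2 = M.*2.
  by rewrite -mul2n /M big_distrr /=; apply: eq_bigr => j _; rewrite mul2n.
lia.
Qed.

(** By tightness [x] is adjacent to its whole class in each colour, and an
    edge has only one colour. *)
Lemma free_tied_inj x y z i j : x \in B -> y \in B -> free x y ->
  z \in B -> z != x -> tied (G i) B x z -> tied (G j) B x z -> i = j.
Proof.
move=> xB yB xy zB zx.
have [_ _ full _ _] := free_pair_tight xB yB xy.
have adj h : tied (G h) B x z -> G h x z.
  move=> xz; have /eqP E : [set w in B | G h x w] == mates (G h) B x.
    by rewrite eqEcard neighbours_sub_mates //=; have := full h; rewrite /gdeg /cls => ->.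
  have : z \in mates (G h) B x by rewrite inE zB zx.
  by rewrite -E inE => /andP[].
by move=> /adj xz /adj; apply: Guniq xz.
Qed.

(** At most one matching number reaches half of [D]; the construction of
    [not_arrows_two_cliques] shows that this cannot be dispensed with. *)
Hypothesis small : forall i j, i != j ->
  (nu (G i) B).*2 < D \/ (nu (G j) B).*2 < D.

(** If [w] were in no free pair, it would be tied to [x] in a single colour [i]
    and to [y] in a single colour [j], with [i] different from [j].  In any
    other colour the classes of [x] and [y] use up the bound, so that [w] is
    alone in its class.  Hence the classes of [w] in colours [i] and [j] cover
    [B].  By tightness each of them has at most [M] vertices besides [w], so
    each has at least [D], against [small]. *)
Lemma in_free_pair x y w : x \in B -> y \in B -> free x y -> w \in B ->
  exists2 z, z \in B & free w z.
Proof.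
move=> xB yB xy wB; apply/exists_inP; apply: contraT.
rewrite negb_exists_in => /forall_inP nofree.
have tiedW z : z \in B -> exists j, tied (G j) B w z.
  by move=> /nofree; rewrite negb_forall => /existsP[j]; rewrite negbK; exists j.
have [i wi] := tiedW x xB; have [j wj] := tiedW y yB.
have yx : free y x by rewrite free_sym.
have wx : w != x.
  by apply: contraTneq xy => <-; apply: nofree.
have wy : w != y.
  by apply: contraTneq yx => <-; apply: nofree.
have trans h := @tied_trans _ _ _ (Bcrit h).
have utx h : tied (G h) B w x -> h = i.
  by move=> xh; apply: (free_tied_inj xB yB xy wB wx); rewrite tied_sym.
have uty h : tied (G h) B w y -> h = j.
  by move=> yh; apply: (free_tied_inj yB xB yx wB wy); rewrite tied_sym.
have ij : i != j.
  apply: contraTneq xy => E; rewrite negb_forall; apply/existsP; exists i.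
  by rewrite negbK; apply: (trans i x w y) => //; [rewrite tied_sym | rewrite E].
have [cardB _ _ sx cxy] := free_pair_tight xB yB xy.
have [_ _ _ sy _] := free_pair_tight yB xB yx.
have wle : #|B| <= (\sum_h cls h w).+1.
  by apply: tied_sum => // z /tiedW[h wz] _; exists h.
have w0 h : h != i -> h != j -> cls h w = 0.
  move=> hi hj.
  have : cls h w + cls h x + cls h y <= (nu (G h) B).*2.
    apply: mates_le3 => //; last by move/forallP: xy.
      by apply: contra hi => /utx ->.
    by apply: contra hj => /uty ->.
  by rewrite -(cxy h) -addnA -[leqRHS]add0n leq_add2r leqn0 => /eqP.
have wi_le : cls i w <= cls i x.
  have : cls i w + cls i y <= (nu (G i) B).*2.
    by apply: mates_le2 => //; apply: contra ij => /uty ->.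
  by rewrite -(cxy i) leq_add2r.
have wj_le : cls j w <= cls j y.
  have : cls j w + cls j x <= (nu (G j) B).*2.
    by apply: mates_le2 => //; apply: contra ij => /utx ->.
  by rewrite -(cxy j) [leqRHS]addnC leq_add2r.
have sw : \sum_h cls h w = cls i w + cls j w.
  rewrite (bigD1 i) //= (bigD1 j) 1?eq_sym //= big1 ?addn0 // => h /andP[hi hj].
  exact: w0.
have xM : cls i x <= M by rewrite -sx (bigD1 i) //= leq_addr.
have yM : cls j y <= M by rewrite -sy (bigD1 j) //= leq_addr.
have xi : cls i x <= (nu (G i) B).*2 := mates_le1 (Bcrit i) xB.
have yj : cls j y <= (nu (G j) B).*2 := mates_le1 (Bcrit j) yB.
have Dle : D <= cls i w /\ D <= cls j w.
  by clear -cardB wle sw wi_le wj_le xM yM; lia.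
by case: (small ij); clear -Dle wi_le wj_le xi yj; lia.
Qed.

(** Every vertex is in a free pair, so colour [k] is regular of odd degree on
    [B]; and [#|B| = D + M + 1] is odd, as [M] is a sum of the even numbers
    [cls j x]. *)
Lemma tight_contradiction x y k : x \in B -> y \in B -> free x y ->
  ~~ odd D -> odd (u k) -> False.
Proof.
move=> xB yB xy Deven kodd.
have := handshake B (Rsym k) (Rirr k).
have regular w : w \in B -> #|[set z in B | R k w z]| = u k.
  move=> wB; have [z zB wz] := in_free_pair xB yB xy wB.
  by have [_ reg _ _ _] := free_pair_tight wB zB wz; rewrite -(reg k).
rewrite (eq_bigr _ regular) sum_nat_const oddM kodd andbT.
have [-> _ _ sx _] := free_pair_tight xB yB xy.
suff /negPf Meven : ~~ odd M by rewrite /= oddD (negPf Deven) Meven.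
rewrite -sx; elim/big_ind: _ => // [a b /negPf ea /negPf eb|j _].
  by rewrite oddD ea eb.
exact: even_mates.
Qed.

End Tight.
End CriticalSet.

Lemma coloring_bound (m : J -> nat) (Q : nat) :
  (forall j, nu (G j) setT <= m j) -> (forall j, m j < Q) -> 0 < Q ->
  Q + \sum_j m j < #|T| ->
  [\/ \sum_k u k < Q | [/\ \sum_k u k <= Q, ~~ odd (\sum_k u k),
     exists k, odd (u k) & forall i j, i != j ->
       (m i).*2 < \sum_k u k \/ (m j).*2 < \sum_k u k]] ->
  False.
Proof.
move=> num mQ Q0 cardT DQ.
have [B [_ Bcrit]] := exists_critical G setT; rewrite cardsT.
have nuB j : nu (G j) B <= m j.
  by apply: leq_trans (num j); apply: nu_mono; apply: subsetT.
have : \sum_j nu (G j) setT <= \sum_j m j by apply: leq_sum.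
move=> le1 le2; have Bbig : Q + \sum_j nu (G j) B < #|B| by lia.
have [/exists_inP[x xB /exists_inP[y yB xy]]|] :=
  boolP [exists x in B, exists y in B, free B x y].
  have := free_pair_bound Bcrit xB yB xy.
  case: DQ => [|[DQ Deven [k kodd] small]]; first by lia.
  move=> _; apply: (tight_contradiction Bcrit _ _ xB yB xy Deven kodd).
    by lia.
  by move=> i j ij; have := nuB i; have := nuB j; case: (small i j ij); lia.
rewrite negb_exists_in => /forall_inP nofree.
have [||i] := all_tied_bound Bcrit; first by lia.
  by move=> x y xB yB _; have := nofree x xB; rewrite negb_exists_in => /forall_inP->.
by have := nuB i; have := mQ i; lia.
Qed.

End Upper.

(** * Stars, matchings and edge colourings *)

Lemma star_copyP (V : finType) (H : graph_on V) (t : nat) :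
  contains_copy H (star t) <-> exists x, t <= #|[set y | H x y]|.
Proof.
split=> [[f [finj fH]]|[x tx]].
  exists (f None); have inj : injective (f \o Some) by move=> i j /finj[].
  rewrite -[leqLHS]card_ord -(card_imset predT inj).
  by apply/subset_leq_card/subsetP => _ /imsetP[i _ ->]; rewrite inE fH.
pose g (i : 'I_t) := enum_val (widen_ord tx i).
have gH i : H x (g i) by have := enum_valP (widen_ord tx i); rewrite inE.
have gx i : g i <> x by move=> E; have := gH i; rewrite E edge_irr.
exists (fun o => if o is Some i then g i else x); split.
  case=> [i|] [j|] //.
  - by move=> /enum_val_inj/(congr1 val)/= /val_inj->.
  - by move/gx.
  - by move/esym/gx.
by case=> [i|] [j|] //= _; rewrite // edge_sym.
Qed.

Lemma matching_copy (V : finType) (H : graph_on V) (n : nat) :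
  n <= nu H setT -> contains_copy H (matching n).
Proof.
have [f /andP[fM /eqP ->]] := exists_maximum H setT.
have fK := matchesK fM.
set L := [set x in moved f | enum_rank x < enum_rank (f x)].
have -> : #|moved f|./2 = #|L|.
  rewrite (@card_free_involution _ (moved f) f) ?doubleK // => x; rewrite !inE //.
  by rewrite fK eq_sym.
move=> nL; pose g (i : 'I_n) := enum_val (widen_ord nL i).
have gL i : g i \in L by apply: enum_valP.
have fgL i : f (g i) \notin L.
  have := gL i; rewrite !inE fK => /andP[_ lt].
  by rewrite negb_and -leqNgt ltnW ?orbT.
have ginj : injective g by move=> i j /enum_val_inj/(congr1 val)/= /val_inj.
exists (fun p => if p.2 then f (g p.1) else g p.1); split.
  move=> [i []] [j []] /=.
  - by move/(inv_inj fK)/ginj->.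
  - by move=> E; have := fgL i; rewrite E gL.
  - by move=> E; have := fgL j; rewrite -E gL.
  - by move/ginj->.
have gf i : H (g i) (f (g i)).
  by have := gL i; rewrite !inE => /andP[/(matches_edge fM)/andP[]].
move=> [i a] [j b] /andP[/eqP /= <-].
by case: a; case: b => //= _; rewrite // edge_sym.
Qed.

(** The edges of the matching that meet [S] meet it in distinct vertices, and
    the others use two vertices of [A] each. *)
Lemma matching_copy_le (V : finType) (H : graph_on V) (n : nat) (S A : {set V}) :
  (forall x y, H x y -> [|| x \in S, y \in S | (x \in A) && (y \in A)]) ->
  contains_copy H (matching n) -> n.*2 <= #|S|.*2 + #|A|.
Proof.
move=> cover [f [finj fH]].
have edge i : H (f (i, false)) (f (i, true)) by apply: fH; rewrite /= /matching_rel /= eqxx.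
pose I := [set i | (f (i, false) \in S) || (f (i, true) \in S)].
have cI : #|I| <= #|S|.
  pose g i := if f (i, false) \in S then f (i, false) else f (i, true).
  rewrite -(card_in_imset (f := g) (D := I)).
    apply/subset_leq_card/subsetP => _ /imsetP[i + ->]; rewrite inE /g.
    by case: ifP.
  by move=> i j _ _; rewrite /g; do 2 case: ifP => _; move=> /finj[].
have cA : #|~: I|.*2 <= #|A|.
  have -> : #|~: I|.*2 = #|[set f p | p in setX (~: I) [set: bool]]|.
    by rewrite card_imset // cardsX cardsT card_bool muln2.
  apply/subset_leq_card/subsetP => _ /imsetP[[i b] + ->].
  rewrite !inE /= andbT negb_or => /andP[/negPf i0 /negPf i1].
  by have := cover _ _ (edge i); rewrite i0 i1 /= => /andP[]; case: b.
have := cardsC I; rewrite card_ord; lia.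
Qed.

Lemma arrows_mono (I : finType) (G : I -> graph) (k n : nat) :
  k <= n -> arrows k G -> arrows n G.
Proof.
move=> kn kG H part.
pose w : 'I_k -> 'I_n := widen_ord kn.
have winj : injective w by move=> x y /(congr1 val) /= /val_inj.
have ws i : symmetric (relpre w (H i)) by move=> x y; apply: edge_sym.
have wi i : irreflexive (relpre w (H i)) by move=> x; apply: edge_irr.
have [|i [f [finj fH]]] := kG (fun i => GraphOn (ws i) (wi i)).
  by move=> x y xy; apply: part; rewrite (inj_eq winj).
by exists i, (w \o f); split=> //; apply: inj_comp.
Qed.

Lemma ramsey_eq (I : finType) (G : I -> graph) (n : nat) :
  0 < #|I| -> arrows n.+1 G -> ~ arrows n G -> ramsey G = n.+1.
Proof.
move=> I0 an nan; have [r0 ar rmin] := ramseyP G I0.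
apply/eqP; rewrite eqn_leq rmin //= ltnNge.
by apply/negP => le; apply: nan; apply: arrows_mono le ar.
Qed.

Section ColorGraph.
Variables (V : finType) (I : eqType) (col : V -> V -> I).
Hypothesis colC : forall x y, col x y = col y x.

Definition color_rel (i : I) : rel V := fun x y => (x != y) && (col x y == i).

Fact color_sym i : symmetric (color_rel i).
Proof. by move=> x y; rewrite /color_rel eq_sym colC. Qed.

Fact color_irr i : irreflexive (color_rel i).
Proof. by move=> x; rewrite /color_rel eqxx. Qed.

Definition color_graph i := GraphOn (color_sym i) (color_irr i).

End ColorGraph.

Lemma not_arrows (V I : finType) (G : I -> graph) (col : V -> V -> I)
    (colC : forall x y, col x y = col y x) :
  (forall i, ~ contains_copy (color_graph colC i) (G i)) -> ~ arrows #|V| G.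
Proof.
move=> free arr; pose e : 'I_#|V| -> V := enum_val.
have einj : injective e := @enum_val_inj _ _.
have eC x y : col (e x) (e y) = col (e y) (e x) by [].
have [|i [f [finj fH]]] := arr (color_graph eC).
  move=> x y xy; exists (col (e x) (e y)); split=> [|i]; rewrite /= /color_rel xy ?eqxx //=.
  by move/eqP.
apply: (free i); exists (e \o f); split=> [|x y /fH]; first exact: inj_comp.
by rewrite /= /color_rel (inj_eq einj).
Qed.

(** * Star colourings of complete graphs *)

(** From a colouring by few colours with degrees at most [d], one gets degrees
    at most [d * u k] by giving [u k] of the colours to each [k]. *)
Lemma merge_colors (W C K : finType) (P : rel W) (u : K -> nat) (d : nat)
    (col : W -> W -> C) :
  (forall x y, col x y = col y x) ->
  (forall x a, #|[set y | P x y && (col x y == a)]| <= d) ->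
  #|C| <= \sum_k u k ->
  exists2 col' : W -> W -> K, forall x y, col' x y = col' y x &
    forall x k, #|[set y | P x y && (col' x y == k)]| <= d * u k.
Proof.
move=> colC deg cC.
have cS : #|{: {k : K & 'I_(u k)}}| = \sum_k u k.
  rewrite card_tagged sumnE big_map big_enum.
  by apply: eq_big => k; rewrite ?card_ord.
rewrite -cS in cC; pose g (a : C) := enum_val (widen_ord cC (enum_rank a)).
have ginj : injective g.
  by move=> a b /enum_val_inj/(congr1 val)/= /val_inj/enum_rank_inj.
exists (fun x y => tag (g (col x y))) => [x y|x k]; first by rewrite colC.
pose F a := [set y | P x y && (col x y == a)].
apply: (@leq_trans (\sum_(a | tag (g a) == k) #|F a|)).
  apply: card_le_sum => y; rewrite inE => /andP[Pxy ck].
  by exists (col x y); rewrite // inE Pxy eqxx.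
apply: (@leq_trans (\sum_(a | tag (g a) == k) d)).
  by apply: leq_sum => a _; apply: deg.
rewrite sum_nat_const mulnC leq_mul2l; apply/orP; right.
rewrite -(card_imset _ ginj).
apply: (@leq_trans #|[set Tagged (fun k => 'I_(u k)) i | i in 'I_(u k)]|).
  apply/subset_leq_card/subsetP => _ /imsetP[a + ->].
  rewrite unfold_in; case: (g a) => k' i /= /eqP E; move: i; rewrite E => i.
  exact: imset_f.
by rewrite -[leqRHS]card_ord; apply: leq_imset_card.
Qed.

Definition star_coloring (W K : finType) (u : K -> nat) (col : W -> W -> K) :=
  (forall x y, col x y = col y x) /\
  forall x k, #|[set y | (y != x) && (col x y == k)]| <= u k.

(** Colouring the pair [x], [y] by [x + y] modulo [q + 1] is proper.  Since the
    loops are coloured as well, it also serves for complete bipartite graphs. *)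
Lemma cyclic_coloring (K : finType) (u : K -> nat) (q : nat) :
  \sum_k u k = q.+1 ->
  exists2 col : 'I_q.+1 -> 'I_q.+1 -> K, forall x y, col x y = col y x &
    forall x k, #|[set y | col x y == k]| <= u k.
Proof.
move=> sq.
have [||col colC deg] := @merge_colors _ _ K (fun _ _ => true) u 1
  (fun x y : 'I_q.+1 => (x + y)%R) (fun x y => addrC x y).
- move=> x a /=; apply/card_le1_eqP => y z; rewrite !inE => /eqP <- /eqP.
  by move/addrI.
- by rewrite card_ord sq.
by exists col => // x k; have := deg x k; rewrite mul1n.
Qed.

(** The round-robin one-factorization: the colour [x + x], which the vertex
    [Some x] misses in the cyclic colouring, goes to its edge to [None]; modulo
    an odd number, [x] is determined by [x + x]. *)
Lemma round_robin_coloring (K : finType) (u : K -> nat) :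
  odd (\sum_k u k) ->
  exists (W : finType) (col : W -> W -> K),
    #|W| = (\sum_k u k).+1 /\ star_coloring u col.
Proof.
case E : (\sum_k u k) => [//|q] qodd; exists (option 'I_q.+1).
have dbl_inj : injective (fun x : 'I_q.+1 => (x + x)%R).
  suff step (x y : 'I_q.+1) : x <= y -> (x + x = y + y)%R -> x = y.
    move=> x y exy; have [le|/ltnW le] := leqP x y; first exact: step.
    by apply/esym/step.
  move=> xy /(congr1 val) /= /eqP; rewrite eq_sym eqn_mod_dvd ?leq_add //.
  have -> : y + y - (x + x) = 2 * (y - x) by lia.
  rewrite Gauss_dvdr; last by rewrite coprimen2.
  move=> /dvdnP[c] H; apply: val_inj => /=; have := ltn_ord y.
  case: c H => [|c]; first lia.
  by rewrite mulSn; lia.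
pose col (x y : option 'I_q.+1) : 'I_q.+1 := match x, y with
  | Some a, Some b => (a + b)%R | Some a, None => (a + a)%R
  | None, Some b => (b + b)%R | None, None => 0%R end.
have [|||col' colC deg] := @merge_colors _ _ K (fun x y => y != x) u 1 col.
- by case=> [a|] [b|] //=; rewrite addrC.
- move=> x a; apply/card_le1_eqP => y z; rewrite !inE.
  move=> /andP[yx /eqP <-] /andP[zx /eqP].
  case: x y z yx zx => [x|] [y|] [z|] //= yx zx.
  + by move/addrI->.
  + by move/addrI => E'; rewrite E' eqxx in yx.
  + by move/addrI => E'; rewrite E' eqxx in zx.
  + by move/dbl_inj->.
- by rewrite card_ord E.
exists col'; split; first by rewrite card_option card_ord.
by split=> // x k; have := deg x k; rewrite mul1n.
Qed.

(** On the integers modulo [2 q + 1], the pairs at a given cyclic distance form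
    a two-regular graph.  The colour [k0] is that of the loop when there is
    only one vertex. *)
Lemma circulant_coloring (K : finType) (k0 : K) (u : K -> nat) :
  (forall k, ~~ odd (u k)) ->
  exists (W : finType) (col : W -> W -> K),
    #|W| = (\sum_k u k).+1 /\ star_coloring u col.
Proof.
move=> ueven; pose v k := (u k)./2.
have uv k : u k = 2 * v k by rewrite mul2n /v even_halfK.
have sv : \sum_k u k = 2 * \sum_k v k by rewrite big_distrr /=; apply: eq_bigr.
rewrite sv; case E : (\sum_k v k) => [|q].
  exists unit, (fun _ _ => k0); split; first by rewrite card_unit.
  split=> // x k; apply: leq_trans (leq0n _).
  by rewrite leqn0 cards_eq0; apply/eqP/setP => y; rewrite !inE; case: x y => -[].
set n := 2 * q.+1; exists 'I_n.+1.
pose dist (x y : 'I_n.+1) : nat := minn (y - x)%R (x - y)%R.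
have distC x y : dist x y = dist y x by rewrite /dist minnC.
have opp (x y : 'I_n.+1) : y != x -> nat_of_ord (x - y)%R + nat_of_ord (y - x)%R = n.+1.
  move=> yx; rewrite -opprB; have := ltn_ord (y - x)%R.
  have : nat_of_ord (y - x)%R != 0.
    by apply: contra yx => /eqP e; rewrite -subr_eq0; apply/eqP/val_inj.
  move: (y - x)%R => w w0 wn; rewrite /= modn_small; lia.
have dist_inj x y z : y != x -> z != x -> dist x y = dist x z ->
    y = z \/ y = (x - z + x)%R.
  move=> yx zx E'.
  have [e|e] : nat_of_ord (y - x)%R = (z - x)%R \/ nat_of_ord (y - x)%R = (x - z)%R.
    by move: E' (opp _ _ yx) (opp _ _ zx); rewrite /dist; clear; lia.
    by left; apply: (addIr (- x)%R); apply: val_inj.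
  by right; rewrite -[y](subrK x); congr (_ + _)%R; apply: val_inj.
have [|||col' colC deg] := @merge_colors _ _ K (fun x y => y != x) v 2
    (fun x y => inord (dist x y).-1 : 'I_q.+1).
- by move=> x y; rewrite distC.
- move=> x a; set S := [set y | _].
  have [->|[y0]] := set_0Vmem S; first by rewrite cards0.
  rewrite inE => /andP[y0x /eqP c0].
  apply: (@leq_trans #|[set y0; (x - y0 + x)%R]|); last by rewrite cards2; case: eqP.
  apply/subset_leq_card/subsetP => y; rewrite !inE => /andP[yx /eqP c1].
  have range z : z != x -> 0 < dist x z <= q.+1.
    move=> zx; have := opp _ _ zx; rewrite /dist.
    have := ltn_ord (x - z)%R; have := ltn_ord (z - x)%R ; clear; lia.
  have : dist x y = dist x y0.
    have r1 := range y yx; have r2 := range y0 y0x.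
    move: c1; rewrite -c0 => /(congr1 val); rewrite /= !inordK //; lia.
  by move=> /(dist_inj _ _ _ yx y0x)[->|->]; rewrite eqxx ?orbT.
- by rewrite card_ord E.
exists col'; split; first by rewrite card_ord.
by split=> // x k; rewrite uv; apply: deg.
Qed.

(** * Extending a coloured complete graph *)

(** The set of the [p j] new vertices meets every edge of colour [j] outside
    [A j], so a matching of colour [j] has at most [p j + #|A j| / 2] edges. *)
Lemma extend_not_arrows (s c : nat) (t : 'I_s -> nat) (n p : 'I_c -> nat)
    (W : finType) (col : W -> W -> 'I_s + 'I_c) (A : 'I_c -> {set W}) :
  (forall k, 0 < t k) ->
  (forall x y, col x y = col y x) ->
  (forall k x, #|[set y | (y != x) && (col x y == inl k)]| < t k) ->
  (forall j x y, x != y -> col x y = inr j -> (x \in A j) && (y \in A j)) ->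
  (forall j, (p j).*2 + #|A j| < (n j).*2) ->
  ~ arrows (#|W| + \sum_j p j)
      (fam_cat (fun k => star (t k)) (fun j => matching (n j))).
Proof.
move=> t0 colC deg inA size; pose S := {j : 'I_c & 'I_(p j)}.
have cS : #|{: S}| = \sum_j p j.
  rewrite card_tagged sumnE big_map big_enum.
  by apply: eq_big => j; rewrite ?card_ord.
rewrite -cS -card_sum.
pose colV (x y : W + S) : 'I_s + 'I_c := match x, y with
  | inl a, inl b => col a b
  | inl _, inr b => inr (tag b)
  | inr a, inl _ => inr (tag a)
  | inr a, inr b => inr (if tag a <= tag b then tag a else tag b) end.
have colVC x y : colV x y = colV y x.
  case: x y => [a|a] [b|b] //=; congr inr.
  by case: ltngtP => // /val_inj.
apply: (not_arrows (colC := colVC)) => -[k|j] /=.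
  rewrite star_copyP => -[[x|a]]; last first.
    rewrite leqNgt => /negP; apply; apply: leq_ltn_trans (t0 k).
    rewrite leqn0 cards_eq0; apply/eqP/setP => y.
    by rewrite !inE; apply/negP; case: y => y /andP[_ /eqP].
  rewrite leqNgt => /negP; apply; apply: leq_ltn_trans (deg k x).
  rewrite -(card_imset _ (@inl_inj W S)); apply/subset_leq_card/subsetP.
  move=> [y|y]; rewrite inE => /andP[xy /eqP] //= ck.
  by rewrite imset_f // inE ck eqxx andbT; apply: contra xy => /eqP->.
pose X : {set W + S} := [set inr (Tagged (fun j => 'I_(p j)) i) | i in 'I_(p j)].
have cX : #|X| <= p j by rewrite -[leqRHS]card_ord; apply: leq_imset_card.
have inX (a : S) : tag a = j -> inr a \in X.
  by case: a => j' i /= E; move: i; rewrite E => i; apply: imset_f.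
move=> /(matching_copy_le (S := X) (A := [set inl x | x in A j])).
rewrite (card_imset _ (@inl_inj W S)) => le.
have := size j; suff : (n j).*2 <= #|X|.*2 + #|A j| by lia.
apply: le => -[x|a] [y|b] /andP[xy /eqP /= ] => [E|[/inX->]|[/inX->]|[]]; rewrite ?orbT //.
  have /andP[xA yA] : (x \in A j) && (y \in A j).
    by apply: inA E; apply: contra xy => /eqP->.
  by rewrite !imset_f // !orbT.
by case: ifP => _ /inX->; rewrite ?orbT.
Qed.

(** * The Ramsey number of stars *)

Section StarRamsey.
Variables (s : nat) (t : s.-tuple nat).
Hypothesis ht : forall i, 0 < tnth t i.

Let u (k : 'I_s) := tnth t k - 1.
Let D := \sum_k u k.

(** Under this condition, star colours with the degrees [u] that fill the
    complete graph of order [D + 1], which is odd, would include a regular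
    graph of odd degree. *)
Definition parity_obstruction :=
  ~~ odd (\sum_(k < s) (tnth t k - 1)) && [exists k : 'I_s, ~~ odd (tnth t k)].

Lemma odd_degree k : odd (u k) = ~~ odd (tnth t k).
Proof. by rewrite /u oddB // addbT. Qed.

Lemma obstruction_witness : parity_obstruction -> ~~ odd D /\ exists k, odd (u k).
Proof.
by move=> /andP[Deven /existsP[k tk]]; split=> //; exists k; rewrite odd_degree.
Qed.

Lemma obstruction_gt0 : parity_obstruction -> 0 < D.
Proof.
move=> /obstruction_witness[_ [k uk]]; apply: leq_trans (odd_gt0 uk) _.
by rewrite /D (bigD1 k) //= leq_addr.
Qed.

Lemma exists_star_coloring :
  0 < s -> exists (W : finType) (col : W -> W -> 'I_s),
    #|W| = D + ~~ parity_obstruction /\ star_coloring u col.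
Proof.
move=> hs; have [obs|] := boolP parity_obstruction.
  have := obstruction_gt0 obs; case E : D => [//|q] _.
  have [col colC deg] := cyclic_coloring E.
  exists 'I_q.+1, col; rewrite card_ord addn0; split=> //; split=> // x k.
  apply: leq_trans (deg x k); apply/subset_leq_card/subsetP => y.
  by rewrite !inE => /andP[].
rewrite addn1 negb_and negbK => /orP[Dodd|].
  exact: round_robin_coloring.
rewrite negb_exists => /forallP allodd.
apply: circulant_coloring (Ordinal hs) _ _ => k.
by rewrite odd_degree; apply: allodd.
Qed.

Lemma ramsey_stars :
  0 < s -> ramsey (fun i => star (tnth t i)) = (D + ~~ parity_obstruction).+1.
Proof.
move=> hs; apply: ramsey_eq; first by rewrite card_ord.
  move=> H part; apply: contrapT => nocopy.
  have deg k x : #|[set y | H k x y]| <= u k.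
    rewrite /u leq_subRL // add1n ltnNge; apply/negP => le.
    by apply: nocopy; exists k; apply/star_copyP; exists x.
  apply: (@coloring_bound _ _ void H (fun j => match j with end) u
    _ _ _ _ _ _ deg (fun=> 0) (D + ~~ parity_obstruction)).
  - by move=> k; apply: edge_sym.
  - by move=> k; apply: edge_irr.
  - by case.
  - by case.
  - by move=> x y /part[k [Hk _]]; left; exists k.
  - by move=> ? ? [].
  - by case.
  - by case.
  - by have := obstruction_gt0; case: parity_obstruction => /= [/(_ isT)|_]; lia.
  - by rewrite big1 // addn0 card_ord.
  have [obs|_] := boolP parity_obstruction; last by constructor 1; rewrite addn1.
  constructor 2; rewrite addn0; have [Deven ex] := obstruction_witness obs.
  by split=> // -[].
have [W [col [<- [colC deg]]]] := exists_star_coloring hs.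
apply: (not_arrows (colC := colC)) => k /star_copyP[x].
rewrite leqNgt => /negP; apply.
have : #|[set y | color_graph colC k x y]| <= u k.
  apply: leq_trans (deg x k); apply/subset_leq_card/subsetP => y.
  by rewrite !inE /= /color_rel eq_sym.
by rewrite /u; have := ht k; lia.
Qed.

End StarRamsey.

(** * The Ramsey number of stars and matchings *)

Section LowerBounds.
Variables (s c : nat) (t : s.-tuple nat) (n : c.-tuple nat).
Hypotheses (ht : forall i, 0 < tnth t i) (hn : forall i, 0 < tnth n i).

Let D := \sum_(i < s) (tnth t i - 1).
Let excess := \sum_(i < c) (tnth n i - 1).
Let family := fam_cat (fun i => star (tnth t i)) (fun i => matching (tnth n i)).

Lemma not_arrows_star_clique :
  0 < s -> ~ arrows (D + ~~ parity_obstruction t + excess) family.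
Proof.
move=> hs; have [W [col [<- [colC deg]]]] := exists_star_coloring ht hs.
apply: (@extend_not_arrows _ _ _ _ _ W (fun x y => inl (col x y)) (fun=> set0)).
- exact: ht.
- by move=> x y; rewrite colC.
- by move=> k x; apply: leq_ltn_trans (deg x k) _; have := ht k; lia.
- by [].
by move=> j; rewrite cards0; have := hn j; lia.
Qed.

Lemma not_arrows_matching_clique (i0 : 'I_c) :
  ~ arrows (tnth n i0 + excess) family.
Proof.
pose A j : {set 'I_((tnth n i0).*2.-1)} := if j == i0 then setT else set0.
pose p j := if j == i0 then 0 else tnth n j - 1.
have -> : tnth n i0 + excess = #|'I_((tnth n i0).*2.-1)| + \sum_j p j.
  rewrite card_ord /excess (bigD1 i0) //= [in RHS](bigD1 i0) //= {1}/p eqxx.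
  rewrite (eq_bigr p) => [|j /negPf ji]; last by rewrite /p ji.
  by rewrite add0n addnA; congr (_ + _); have := hn i0; lia.
apply: (@extend_not_arrows _ _ _ _ _ _ (fun _ _ => inr i0) A) => //.
- move=> k x; apply: leq_ltn_trans (ht k).
  rewrite leqn0 cards_eq0; apply/eqP/setP => y.
  by rewrite !inE; apply/negP => /andP[_ /eqP].
- by move=> j x y _ [<-]; rewrite /A eqxx !inE.
move=> j; rewrite /A /p; have := hn j; case: eqP => [->|_].
  by rewrite cardsT card_ord; lia.
by rewrite cards0; lia.
Qed.

(** The cliques consist of [None] and one of the two copies of ['I_D].  The
    complete bipartite graph between the copies splits into [D] perfect
    matchings, so each vertex of the copies gets [D] red edges.  As [D] is even, a
    clique of order [D + 1] only uses up [D / 2] of the matching number. *)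
Lemma not_arrows_two_cliques (i0 i1 : 'I_c) :
  i0 != i1 -> 0 < D -> ~~ odd D -> D < (tnth n i0).*2 -> D < (tnth n i1).*2 ->
  ~ arrows (D.+1 + excess) family.
Proof.
move=> i01 D0 Deven Di0 Di1.
have [q Dq] : exists q, D = q.+1 by exists D.-1; rewrite prednK.
have [cyc cycC deg] := cyclic_coloring Dq.
have [e De] : exists e, D = e.*2 by exists D./2; rewrite even_halfK.
pose W := option ('I_q.+1 + 'I_q.+1).
pose col (x y : W) : 'I_s + 'I_c := match x, y with
  | Some (inl a), Some (inr b) | Some (inr a), Some (inl b) => inl (cyc a b)
  | Some (inr _), _ | _, Some (inr _) => inr i1
  | _, _ => inr i0 end.
pose A (j : 'I_c) : {set W} :=
  if j == i0 then [set omap inl a | a in {: option 'I_q.+1}]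
  else if j == i1 then [set omap inr a | a in {: option 'I_q.+1}] else set0.
pose p j := tnth n j - 1 - (if (j == i0) || (j == i1) then e else 0).
have -> : D.+1 + excess = #|{: W}| + \sum_j p j.
  have rest : \sum_(j | (j != i0) && (j != i1)) p j
      = \sum_(j | (j != i0) && (j != i1)) (tnth n j - 1).
    apply: eq_bigr => j /andP[/negPf j0 /negPf j1].
    by rewrite /p j0 j1 subn0.
  rewrite card_option card_sum card_ord /excess (bigD1 i0) // (bigD1 i1) 1?eq_sym //=.
  rewrite [in RHS](bigD1 i0) // [in RHS](bigD1 i1) 1?eq_sym //= rest.
  rewrite {1 2}/p !eqxx orbT /= -Dq; clear -De Di0 Di1; lia.
have mem0 (a : option 'I_q.+1) : omap inl a \in A i0 by rewrite /A eqxx imset_f.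
have mem1 (a : option 'I_q.+1) : omap inr a \in A i1.
  by rewrite /A eq_sym (negPf i01) eqxx imset_f.
apply: (@extend_not_arrows _ _ _ _ _ {: W} col A) => //.
- by move=> [[a|a]|] [[b|b]|] //=; rewrite cycC.
- move=> k x; apply: (@leq_ltn_trans (tnth t k - 1)); last by have := ht k; lia.
  pose S := [set y | (y != x) && (col x y == inl k)].
  have bound (f : 'I_q.+1 -> W) (a : 'I_q.+1) : injective f ->
      (forall y, col x y = inl k -> exists2 b, y = f b & cyc a b = k) ->
      #|S| <= tnth t k - 1.
    move=> finj colf; apply: leq_trans (deg a k); rewrite -(card_imset _ finj).
    apply/subset_leq_card/subsetP => y; rewrite inE => /andP[_ /eqP /colf[b -> ab]].
    by rewrite imset_f // inE ab.
  case: x @S bound => [[a|a]|] S bound.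
  + apply: (bound (Some \o inr) a) => [y z [] //|[[b|b]|] //= [E]].
    by exists b.
  + apply: (bound (Some \o inl) a) => [y z [] //|[[b|b]|] //= [E]].
    by exists b.
  apply: leq_trans (leq0n _); rewrite leqn0 cards_eq0; apply/eqP/setP => y.
  by rewrite !inE; apply/negP => /andP[_ /eqP]; case: y => [[b|b]|].
- move=> j x y xy E; case: x y xy E => [[a|a]|] [[b|b]|] //= _ [<-].
  + by rewrite (mem0 (Some a)) (mem0 (Some b)).
  + by rewrite (mem0 (Some a)) (mem0 None).
  + by rewrite (mem1 (Some a)) (mem1 (Some b)).
  + by rewrite (mem1 (Some a)) (mem1 None).
  + by rewrite (mem0 None) (mem0 (Some b)).
  + by rewrite (mem1 None) (mem1 (Some b)).
move=> j; rewrite /A /p; have card_side (f : option 'I_q.+1 -> W) :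
    #|[set f a | a in {: option 'I_q.+1}]| <= D.+1.
  by apply: leq_trans (leq_imset_card _ _) _; rewrite card_option card_ord Dq.
have [->|_] := eqVneq j i0.
  rewrite /=; apply: leq_ltn_trans (leq_add (leqnn _) (card_side _)) _.
  by clear -De Di0; lia.
have [->|_] := eqVneq j i1.
  rewrite /=; apply: leq_ltn_trans (leq_add (leqnn _) (card_side _)) _.
  by clear -De Di1; lia.
by rewrite cards0; have := hn j; lia.
Qed.

End LowerBounds.

(** The parity obstruction turns [D.+1] into [D], unless a colouring by one or
    two cliques recovers the lost vertex. *)
Lemma ramsey_stars_matchings (s c : nat) (t : s.-tuple nat) (n : c.-tuple nat) :
  0 < s -> 0 < c -> (forall i, 0 < tnth t i) -> (forall i, 0 < tnth n i) ->
  (forall i j : 'I_c, i <= j -> tnth n j <= tnth n i) ->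
  let D := \sum_(i < s) (tnth t i - 1) in
  let n1 := nth 0 n 0 in let n2 := nth 0 n 1 in
  let Q := if parity_obstruction t && (maxn n1 (2 * n2) <= D) then D
           else maxn D.+1 n1 in
  ramsey (fam_cat (fun i => star (tnth t i)) (fun i => matching (tnth n i)))
    = (Q + \sum_(i < c) (tnth n i - 1)).+1.
Proof.
move=> hs hc ht hn sorted D n1 n2 Q.
pose i0 : 'I_c := Ordinal hc.
have n1E : n1 = tnth n i0 by rewrite (tnth_nth 0).
have n_le1 i : tnth n i <= n1 by rewrite n1E sorted.
have n_le2 (i : 'I_c) : 0 < i -> tnth n i <= n2.
  move=> i1; have c1 : 1 < c by apply: leq_ltn_trans (ltn_ord i).
  by have := @sorted (Ordinal c1) i i1; rewrite [tnth n (Ordinal _)](tnth_nth 0).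
have n1Q : n1 <= Q by rewrite /Q; case: ifP => [/andP[_]|_]; lia.
have n1_gt0 : 0 < n1 by rewrite n1E.
have DQ : D <= Q by rewrite /Q; case: ifP => _; lia.
apply: ramsey_eq; first by rewrite card_sum !card_ord addn_gt0 hs.
  move=> H part; apply: contrapT => nocopy.
  have deg k x : #|[set y | H (inl k) x y]| <= tnth t k - 1.
    rewrite leq_subRL // add1n ltnNge; apply/negP => le.
    by apply: nocopy; exists (inl k); apply/star_copyP; exists x.
  apply: (@coloring_bound _ _ _ (fun k => edge (H (inl k)))
    (fun j => edge (H (inr j))) (fun k => tnth t k - 1)
    _ _ _ _ _ _ deg (fun j => tnth n j - 1) Q).
  - by move=> k; apply: edge_sym.
  - by move=> k; apply: edge_irr.
  - by move=> j; apply: edge_sym.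
  - by move=> j; apply: edge_irr.
  - by move=> x y /part[[k|j] [Hi _]]; [left; exists k | right; exists j].
  - move=> x y i j Hi Hj; have xy : x != y.
      by apply: contraTneq Hi => ->; rewrite edge_irr.
    have [l [_ uniq]] := part x y xy.
    by have := uniq _ Hi; rewrite (uniq _ Hj) => -[].
  - move=> j; rewrite leq_subRL // add1n ltnNge; apply/negP => le.
    by apply: nocopy; exists (inr j); apply: matching_copy.
  - by move=> j; have := n_le1 j; have := hn j; lia.
  - by lia.
  - by rewrite card_ord.
  rewrite -/D /Q; case: ifP => [/andP[obs n12D]|_]; last first.
    by constructor 1; rewrite leq_max ltnSn.
  constructor 2; have [Deven ex] := obstruction_witness ht obs; split=> // i j ij.
  have [i1|] := posnP i; last first.
    by move=> /n_le2; have := hn i; left; lia.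
  have j1 : 0 < j.
    by rewrite lt0n; apply: contra ij => /eqP j1; apply/eqP/val_inj; rewrite /= i1.
  by have := n_le2 j j1; have := hn j; right; lia.
rewrite /Q; case: ifP => [/andP[obs _]|/negbT].
  by have := not_arrows_star_clique ht hn hs; rewrite obs addn0.
rewrite negb_and -ltnNge => notboth.
have [_|Dn1] := leqP D.+1 n1.
  by rewrite n1E; apply: not_arrows_matching_clique.
have [obs|nobs] := boolP (parity_obstruction t); last first.
  by have := not_arrows_star_clique ht hn hs; rewrite nobs addn1.
rewrite obs /= in notboth.
have [Deven _] := obstruction_witness ht obs.
have c1 : 1 < c.
  rewrite -[c](size_tuple n) ltnNge; apply/negP => /(nth_default 0).
  by move=> n20; move: notboth; rewrite /n2 n20; lia.
have n2E : n2 = tnth n (Ordinal c1) by rewrite (tnth_nth 0).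
apply: (not_arrows_two_cliques ht hn (i0 := i0) (i1 := Ordinal c1)) => //.
- exact: obstruction_gt0.
- by have := n_le1 (Ordinal c1); rewrite -n1E -n2E; lia.
- by rewrite -n2E; lia.
Qed.

Local Open Scope ring_scope.

Theorem theorem1p2 (s c : nat) (hs : (1 <= s)%N) (hc : (1 <= c)%N)
    (t : s.-tuple nat) (n : c.-tuple nat)
    (ht : forall i : 'I_s, (0 < tnth t i)%N)
    (hn : forall i : 'I_c, (0 < tnth n i)%N)
    (hsorted : forall i j : 'I_c, (i <= j)%N -> (tnth n j <= tnth n i)%N) :
  let Sigma : nat := (\sum_(i < s) (tnth t i - 1))%N in
  let stars : 'I_s -> graph := fun i => star (tnth t i) in
  let matchings : 'I_c -> graph := fun i => matching (tnth n i) in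
  let r : nat := ramsey stars in
  let n1 : nat := nth 0%N n 0 in
  (* if c = 1 then n2 = 0, so that maxn n1 (2 * n2) = n1 *)
  let n2 : nat := nth 0%N n 1 in
  let delta : int :=
    if [&& (Sigma < maxn n1 (2 * n2))%N, ~~ odd Sigma
         & [exists i : 'I_s, ~~ odd (tnth t i)]]
    then 0 else -1 in
  (ramsey (fam_cat stars matchings))%:Z
    = Num.max (r%:Z + delta) n1%:Z + \sum_(i < c) ((tnth n i)%:Z - 1) + 1.
Proof.
move=> Sigma stars matchings r n1 n2 delta.
rewrite /r /stars /matchings ramsey_stars // ramsey_stars_matchings //.
have -> : \sum_(i < c) ((tnth n i)%:Z - 1) = (\sum_(i < c) (tnth n i - 1))%N%:Z.
  rewrite (big_morph Posz PoszD (erefl _)); apply: eq_bigr => i _.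
  by rewrite subzn.
rewrite /delta -/Sigma -/n1 -/n2.
rewrite -[~~ odd Sigma && _]/(parity_obstruction t).
move: (\sum_(i < c) _)%N => excess.
by case: (parity_obstruction t); case: ltnP => /=; lia.
Qed.
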